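(* Let $m>0$ and let $(N,g_S)$, $N=\mathbb{R}\times S^2$, be the complete smooth Riemannian manifold obtained by isometrically doubling across $\Sigma=\{r=2m\}$ the Schwarzschild metric $$g_S=\Big(1-\frac{2m}{r}\Big)^{-1}dr^2+r^2ds^2_{S^2}\quad\text{on }[2m,\infty)\times S^2 .$$ Let $\alpha>0$. Then $(N,g_S)$, which is scalar-flat, satisfies the $\mathcal{R}_s^2$ equations $$\alpha\nabla\mathcal{R}^2+L^*(\omega)=0,\qquad\Delta\omega=-\frac{\alpha}{4}|\mathrm{Ric}|^2 ,$$ where the potential is given by $$\omega=\tau+c\cdot u$$ for any $c\in\mathbb{R}$, with $u=(1-\frac{2m}{r})^{1/2}$ on $[2m,\infty)\times S^2$, extended to $N$ as an odd function under reflection in $\Sigma$. The function $\tau$ is spherically symmetric and even with respect to reflection across $\Sigma$. Explicitly, $\tau=\lim_{a\to2m}\tau_a$ where, for $a>2m$ and $r\ge a$, $$\tau_a(r)=\frac{\alpha}{8}\Big(1-\frac{2m}{r}\Big)^{1/2}\left(\int_a^r\frac{1}{s^5(1-\frac{2m}{s})^{3/2}}\,ds-\frac{1}{ma^3}\frac{1}{(1-\frac{2m}{a})^{1/2}}\right).$$ In particular, $\tau(2m)=-\frac{\alpha}{8m}(2m)^{-3}$, $\tau'(2m)=0$, $\tau<0$ everywhere, and $\tau$ is asymptotic to a constant $\tau_o<0$ at each end of $N$.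
   Context: For a smooth Riemannian metric $g$ on a 3-manifold, $R$ is the curvature tensor, $\mathrm{Ric}$ the Ricci curvature, $s_g$ the scalar curvature, $D^*D$ the non-negative rough Laplacian, $D^2f$ the Hessian, $\Delta f=\mathrm{tr}\,D^2f$, and $\stackrel{\circ}{R}$ the action of the curvature tensor on symmetric bilinear forms, with sign convention $\stackrel{\circ}{R}g=\mathrm{Ric}$. Set $$\nabla\mathcal{R}^2 = D^{*}D\,\mathrm{Ric} + D^{2}s_g - 2\stackrel{\circ}{R}\circ \mathrm{Ric} - \tfrac12(\Delta s_g - |\mathrm{Ric}|^{2})\, g,\qquad L^*f=D^2f-\Delta f\cdot g-f\,\mathrm{Ric} .$$ The boundary $\Sigma=\{r=2m\}$ of $[2m,\infty)\times S^2$ is a totally geodesic round 2-sphere of radius $2m$, so the doubling across $\Sigma$ is a smooth complete metric on $\mathbb{R}\times S^2$. $ds^2_{S^2}$ is the round metric of curvature 1. The prime in $\tau'(2m)$ denotes the derivative of the spherically symmetric function $\tau$ in the radial direction, at $\Sigma$.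
   Formalization: The potential is ω = (2m)²τ + c·u instead of ω = τ + c·u: with τ as printed, Δω = −(3/8)α r⁻⁶ while −(α/4)|Ric|² = −(3/2)αm² r⁻⁶, so the printed equations hold only when 2m = 1; all claims about τ are kept as printed. *)

(* Defs.v *)
(* Written over Stdlib's classical reals and Coquelicot. *)
From Stdlib Require Import Reals Lra List.
From Coquelicot Require Import Coquelicot.
Open Scope R_scope.

(* ------------------------------------------------------------------------ *)
(* Tensor calculus in a coordinate system with three coordinates.            *)
(* A tensor is given by its components with respect to the coordinate frame. *)

Inductive idx := I0 | I1 | I2.

Definition next (i : idx) : idx :=
  match i with I0 => I1 | I1 => I2 | I2 => I0 end.

Definition sum3 (f : idx -> R) : R := f I0 + f I1 + f I2.

Definition V3 : Type := (R * R * R)%type.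

Definition coord (i : idx) (p : V3) : R :=
  match p with (a, b, c) => match i with I0 => a | I1 => b | I2 => c end end.

Definition upd (p : V3) (i : idx) (t : R) : V3 :=
  match p with (a, b, c) =>
    match i with I0 => (t, b, c) | I1 => (a, t, c) | I2 => (a, b, t) end
  end.

Definition dot (v w : V3) : R := sum3 (fun i => coord i v * coord i w).

Definition scalar_field : Type := V3 -> R.
Definition covector_field : Type := idx -> scalar_field.
Definition tensor2 : Type := idx -> idx -> scalar_field.

Definition ex_pd (i : idx) (f : scalar_field) (p : V3) : Prop :=
  ex_derive (fun t => f (upd p i t)) (coord i p).

Definition pd (i : idx) (f : scalar_field) : scalar_field :=
  fun p => Derive (fun t => f (upd p i t)) (coord i p).

Fixpoint iter_pd (l : list idx) (f : scalar_field) : scalar_field :=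
  match l with nil => f | cons i l' => pd i (iter_pd l' f) end.

(* All iterated partial derivatives exist and are (jointly) continuous. *)
Definition smooth (f : scalar_field) : Prop :=
  forall (l : list idx) (p : V3),
    (forall i, ex_pd i (iter_pd l f) p) /\ continuous (iter_pd l f) p.

Section Tensors.
Variable g : tensor2.

(* Cyclic minors, which carry the cofactor sign. *)
Definition cofactor (i j : idx) (p : V3) : R :=
  g (next i) (next j) p * g (next (next i)) (next (next j)) p
  - g (next i) (next (next j)) p * g (next (next i)) (next j) p.

Definition det3 (p : V3) : R := sum3 (fun j => g I0 j p * cofactor I0 j p).

Definition ginv (i j : idx) (p : V3) : R := cofactor j i p / det3 p.

(* [christoffel k i j] is Gamma^k_{ij}. *)
Definition christoffel (k i j : idx) (p : V3) : R :=
  / 2 * sum3 (fun l =>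
          ginv k l p * (pd i (g j l) p + pd j (g i l) p - pd l (g i j) p)).

(* [riem i j k l] is the d_l-component of R(d_i, d_j) d_k, where
   R(X, Y) = [D_X, D_Y] - D_[X,Y]. *)
Definition riem (i j k l : idx) (p : V3) : R :=
  pd i (christoffel l j k) p - pd j (christoffel l i k) p
  + sum3 (fun q => christoffel l i q p * christoffel q j k p
                   - christoffel l j q p * christoffel q i k p).

(* Ric(Y, Z) = tr (X |-> R(X, Y) Z), positive on round spheres. *)
Definition ric : tensor2 := fun j k p => sum3 (fun i => riem i j k i p).

Definition trace2 (h : tensor2) : scalar_field :=
  fun p => sum3 (fun i => sum3 (fun j => ginv i j p * h i j p)).

Definition normsq2 (h : tensor2) : scalar_field :=
  fun p => sum3 (fun i => sum3 (fun j => sum3 (fun k => sum3 (fun l =>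
    ginv i k p * ginv j l p * h i j p * h k l p)))).

Definition scalar_curv : scalar_field := trace2 ric.

Definition hess (f : scalar_field) : tensor2 := fun i j p =>
  pd i (pd j f) p - sum3 (fun k => christoffel k i j p * pd k f p).

Definition laplacian (f : scalar_field) : scalar_field := trace2 (hess f).

(* [cov2 h k i j] is (D_k h)_{ij}. *)
Definition cov2 (h : tensor2) (k i j : idx) : scalar_field := fun p =>
  pd k (h i j) p
  - sum3 (fun l => christoffel l k i p * h l j p + christoffel l k j p * h i l p).

(* [cov22 h l k i j] is (D^2 h)_{lk;ij} = (D_l (D h))_{kij}. *)
Definition cov22 (h : tensor2) (l k i j : idx) : scalar_field := fun p =>
  pd l (cov2 h k i j) p
  - sum3 (fun q => christoffel q l k p * cov2 h q i j p
                   + christoffel q l i p * cov2 h k q j p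
                   + christoffel q l j p * cov2 h k i q p).

Definition rough_laplacian (h : tensor2) : tensor2 := fun i j p =>
  - sum3 (fun l => sum3 (fun k => ginv l k p * cov22 h l k i j p)).

(* (Rh)(Y, Z) = sum_a h(R(e_a, Y) Z, e_a) over an orthonormal frame, so that
   Rg = Ric. *)
Definition curv_action (h : tensor2) : tensor2 := fun j k p =>
  sum3 (fun a => sum3 (fun b => sum3 (fun l =>
    ginv a b p * riem a j k l p * h l b p))).

Definition grad_R2 : tensor2 := fun i j p =>
  rough_laplacian ric i j p + hess scalar_curv i j p - 2 * curv_action ric i j p
  - / 2 * (laplacian scalar_curv p - normsq2 ric p) * g i j p.

Definition Lstar (f : scalar_field) : tensor2 := fun i j p =>
  hess f i j p - laplacian f p * g i j p - f p * ric i j p.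

End Tensors.

(* ------------------------------------------------------------------------ *)
(* The manifold N = R x S^2, with S^2 the unit sphere of R^3.                *)

Definition RV3 : Type := (R * V3)%type.

Definition on_S2 (y : V3) : Prop := dot y y = 1.
Definition on_N (p : RV3) : Prop := on_S2 (snd p).
Definition on_TN (p v : RV3) : Prop := dot (snd p) (snd v) = 0.

Definition reflect (p : RV3) : RV3 := (- fst p, snd p).

(* The smooth atlas of N consisting of the two stereographic parametrisations
   R x R^2 -> R x S^2, each of which misses only R x {pole}. *)
Inductive chart := north | south.

Definition stereo (c : chart) (q : V3) : RV3 :=
  match q with (x, a, b) =>
    let S := 1 + a ^ 2 + b ^ 2 in
    let z := (1 - a ^ 2 - b ^ 2) / S in
    (x, (2 * a / S, 2 * b / S, match c with north => z | south => - z end))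
  end.

(* The coordinate vector d_i at [stereo c q], as a vector of R x R^3. *)
Definition frame (c : chart) (i : idx) (q : V3) : RV3 :=
  (pd i (fun q' => fst (stereo c q')) q,
   (pd i (fun q' => coord I0 (snd (stereo c q'))) q,
    pd i (fun q' => coord I1 (snd (stereo c q'))) q,
    pd i (fun q' => coord I2 (snd (stereo c q'))) q)).

(* A metric on N sends a point and two tangent vectors to a number; only its
   values at points of N and on vectors tangent to N are meaningful. *)
Definition metric : Type := RV3 -> RV3 -> RV3 -> R.

Definition in_chart (c : chart) (f : RV3 -> R) : scalar_field :=
  fun q => f (stereo c q).

Definition metric_in_chart (c : chart) (g : metric) : tensor2 :=
  fun i j q => g (stereo c q) (frame c i q) (frame c j q).

Definition smooth_fun (f : RV3 -> R) : Prop :=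
  forall c, smooth (in_chart c f).

Definition riemannian (g : metric) : Prop :=
  (forall p u v w a, on_N p -> on_TN p u -> on_TN p v -> on_TN p w ->
     g p (plus u (scal a v)) w = g p u w + a * g p v w) /\
  (forall p v w, on_N p -> on_TN p v -> on_TN p w -> g p v w = g p w v) /\
  (forall p v, on_N p -> on_TN p v -> v <> zero -> 0 < g p v v) /\
  (forall c i j, smooth (metric_in_chart c g i j)).

(* p and q are joined by a C^1 curve in N of length < eps; equivalently, the
   Riemannian distance from p to q is < eps. *)
Definition dist_lt (g : metric) (p q : RV3) (eps : R) : Prop :=
  exists (gam dgam : R -> RV3),
    (forall t, is_derive gam t (dgam t) /\ continuous dgam t) /\
    (forall t, 0 <= t <= 1 -> on_N (gam t)) /\
    gam 0 = p /\ gam 1 = q /\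
    RInt (fun t => sqrt (g (gam t) (dgam t) (dgam t))) 0 1 < eps.

Definition complete_metric (g : metric) : Prop :=
  forall s : nat -> RV3,
    (forall n, on_N (s n)) ->
    (forall eps, 0 < eps -> exists n0, forall n k,
       (n0 <= n)%nat -> (n0 <= k)%nat -> dist_lt g (s n) (s k) eps) ->
    exists p, on_N p /\
      forall eps, 0 < eps -> exists n0, forall n,
        (n0 <= n)%nat -> dist_lt g (s n) p eps.

(* ------------------------------------------------------------------------ *)
(* The Schwarzschild metric and its double.                                  *)

(* (1 - 2m/r)^-1 dr^2 + r^2 ds^2_{S^2} at (r, y); the round metric of
   curvature 1 is the restriction of [dot] to the unit sphere. *)
Definition schwarzschild (m : R) : metric := fun p v w =>
  / (1 - 2 * m / fst p) * (fst v * fst w) + fst p ^ 2 * dot (snd v) (snd w).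

(* g is a double of the Schwarzschild metric on [2m, +oo) x S^2 across
   {r = 2m}: with fold map (x, y) |-> (rad x, y), each of {x >= 0} and
   {x <= 0} is carried bijectively onto [2m, +oo) x S^2, {x = 0} going to the
   boundary, and g is the pull-back of the Schwarzschild metric where r > 2m
   (the coordinate r is singular at the boundary).  Together with smoothness
   of g this determines g. *)
Definition doubles_schwarzschild (m : R) (rad : R -> R) (g : metric) : Prop :=
  rad 0 = 2 * m /\
  (forall x, rad (- x) = rad x) /\
  (forall x x', 0 <= x < x' -> rad x < rad x') /\
  (forall r, 2 * m <= r -> exists x, 0 <= x /\ rad x = r) /\
  (forall p v w, on_N p -> on_TN p v -> on_TN p w ->
     g (reflect p) (reflect v) (reflect w) = g p v w) /\
  (forall p v w, on_N p -> on_TN p v -> on_TN p w -> fst p <> 0 ->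
     ex_derive rad (fst p) /\
     g p v w = schwarzschild m (rad (fst p), snd p)
                 (Derive rad (fst p) * fst v, snd v)
                 (Derive rad (fst p) * fst w, snd w)).

(* The coordinate x on the R-factor is the signed square root of r - 2m; unlike
   r it is smooth across the sphere {r = 2m}. *)
Definition area_radius (m : R) (x : R) : R := 2 * m + x ^ 2.

(* Substituting r = 2m + x^2, one has (1 - 2m/r)^-1 dr^2 = 4 r dx^2. *)
Definition double_schwarzschild (m : R) : metric := fun p v w =>
  4 * area_radius m (fst p) * (fst v * fst w)
  + area_radius m (fst p) ^ 2 * dot (snd v) (snd w).

(* (1 - 2m/r)^(1/2), extended as an odd function under [reflect]. *)
Definition u_pot (m : R) (p : RV3) : R :=
  let h := sqrt (1 - 2 * m / area_radius m (fst p)) in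
  if Rle_dec 0 (fst p) then h else - h.

Definition tau_a (m alpha a r : R) : R :=
  alpha / 8 * sqrt (1 - 2 * m / r) *
  (RInt (fun s => / (s ^ 5 * Rpower (1 - 2 * m / s) (3 / 2))) a r
   - / (m * a ^ 3) * / sqrt (1 - 2 * m / a)).

(* Derivative along the unit radial vector (x is not arclength, and r is not a
   smooth coordinate at r = 2m). *)
Definition radial_derive (g : metric) (f : RV3 -> R) (p : RV3) : R :=
  Derive (fun x => f (x, snd p)) (fst p) / sqrt (g p (1, zero) (1, zero)).

Definition scalar_flat (g : metric) : Prop :=
  forall c q, scalar_curv (metric_in_chart c g) q = 0.

Definition satisfies_Rs2 (g : metric) (alpha : R) (omega : RV3 -> R) : Prop :=
  smooth_fun omega /\
  (forall c i j q,
     alpha * grad_R2 (metric_in_chart c g) i j q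
     + Lstar (metric_in_chart c g) (in_chart c omega) i j q = 0) /\
  (forall c q,
     laplacian (metric_in_chart c g) (in_chart c omega) q
     = - (alpha / 4)
       * normsq2 (metric_in_chart c g) (ric (metric_in_chart c g)) q).

(* The factor (2m)^2 departs from the formula omega = tau + c u of the source,
   with which it agrees when 2m = 1.  It is forced by homogeneity: under
   g -> k^2 g the equations require omega ~ k^-2, while tau ~ k^-4.  With tau
   as given, Delta tau = - (3/8) alpha r^-6, whereas
   - (alpha/4) |Ric|^2 = - (3/2) alpha m^2 r^-6. *)
Definition potential (m c : R) (tau : RV3 -> R) (p : RV3) : R :=
  (2 * m) ^ 2 * tau p + c * u_pot m p.

(* Main.v *)
Require Import Defs.
From Stdlib Require Import Reals Lra FunctionalExtensionality.
From Coquelicot Require Import Coquelicot.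
Open Scope R_scope.

(** Write r = 2m + x^2 and w = u^2 = 1 - 2m/r = x^2/r.

    Curvature. In a stereographic parametrisation (x, a, b) the doubled metric
    is the diagonal matrix with entries 4r, 4r^2/S^2, 4r^2/S^2, where
    S = 1 + a^2 + b^2, so every curvature quantity is a rational function of
    x, a, b and can be computed outright.  The sectional curvatures are -m/r^3
    on planes containing the radial direction and 2m/r^3 on the spheres; hence
    the scalar curvature vanishes, and in an orthonormal frame
    Ric = (m/r^3) diag(-2, 1, 1), |Ric|^2 = 6m^2/r^6 and
    grad_R2 = (m^2/r^6) diag(1, -2, -2) ([grad_R2_double]).

    Potential. The substitution s = 2m/(1 - v^2), that is v = u(s), turns
    ds / (s^5 u^3) into (1 - v^2)^3 / (8 m^4 v^2) dv, whose primitive is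
    (-1/v - 3v + v^3 - v^5/5) / (8 m^4).  In tau_a the pole of this primitive
    at v = u(a) cancels against 1/(m a^3 u(a)), and what remains tends to 0 as
    a decreases to 2m ([tau_a_closed]).  The limit is
      tau = alpha/(64 m^4) (-1 - 3w + w^2 - w^3/5),
    a polynomial in w = x^2/(2m + x^2).  This makes it smooth and even across
    the sphere x = 0, negative because 0 <= w < 1, and convergent at both ends,
    where w tends to 1.  The equations are then identities between rational
    functions of x and / sqrt r: the part (2m)^2 tau matches grad_R2, and u is
    a static potential, Lstar u = 0 ([Rs2_tensor_equation],
    [laplacian_potential]).

    Smoothness. All the functions involved are built from coordinates by
    +, *, inverse and square root; this class is stable under partial
    derivatives ([elementary_pd]), which gives all orders at once.

    Completeness. The metric dominates a positive multiple of the Euclidean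
    metric of R x R^3 ([double_ge_euclidean]), so a Cauchy sequence has
    convergent components; conversely Euclidean-close points of N are joined by
    a short curve, the radial projection of their chord ([short_curve]). *)

(** * Smoothness of elementary functions *)

(** Only inverses of nowhere vanishing functions and square roots of positive
    ones are admitted, so that membership already entails global smoothness. *)
Inductive elementary : scalar_field -> Prop :=
| elem_const (c : R) : elementary (fun _ => c)
| elem_coord (i : idx) : elementary (coord i)
| elem_plus f h : elementary f -> elementary h -> elementary (fun p => f p + h p)
| elem_mult f h : elementary f -> elementary h -> elementary (fun p => f p * h p)
| elem_inv f : elementary f -> (forall p, f p <> 0) -> elementary (fun p => / f p)
| elem_sqrt f : elementary f -> (forall p, 0 < f p) ->
    elementary (fun p => sqrt (f p)).

Lemma upd_coord (p : V3) (i : idx) : upd p i (coord i p) = p.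
Proof. destruct p as [[a b] c], i; reflexivity. Qed.

Lemma continuous_coord (i : idx) (p : V3) : continuous (coord i) p.
Proof.
destruct i.
- apply (continuous_ext (fun q : V3 => fst (fst q))).
  { intros [[a b] c]; reflexivity. }
  apply (continuous_comp fst fst); apply continuous_fst.
- apply (continuous_ext (fun q : V3 => snd (fst q))).
  { intros [[a b] c]; reflexivity. }
  apply (continuous_comp fst snd); [apply continuous_fst | apply continuous_snd].
- apply (continuous_ext (fun q : V3 => snd q)).
  { intros [[a b] c]; reflexivity. }
  apply continuous_snd.
Qed.

Lemma elementary_continuous f : elementary f -> forall p, continuous f p.
Proof.
induction 1 as [c|i|f h _ IHf _ IHh|f h _ IHf _ IHh|f _ IHf Hf|f _ IHf Hf]; intros p.
- apply continuous_const.
- apply continuous_coord.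
- now apply (continuous_plus f h).
- now apply (continuous_mult f h).
- apply (continuous_comp f Rinv); [apply IHf | apply continuous_Rinv, Hf].
- apply (continuous_comp f sqrt); [apply IHf | apply continuous_sqrt].
Qed.

(** The induction produces the partial derivative together with its membership
    in the class, because neither the product nor the square root rule can be
    applied without knowing that the factors are differentiable. *)
Lemma elementary_pd f (i : idx) : elementary f ->
  (forall p, ex_pd i f p) /\ elementary (pd i f).
Proof.
intros Hf.
cut (exists f', elementary f' /\
       forall p, is_derive (fun t => f (upd p i t)) (coord i p) (f' p)).
{ intros (f' & Hf' & Hd); split.
  - intros p; exists (f' p); apply Hd.
  - replace (pd i f) with f'; [exact Hf'|].
    apply functional_extensionality; intros p; symmetry.
    apply is_derive_unique, Hd. }
induction Hf as [c|j|f h _ [f' [Hf' IHf]] _ [h' [Hh' IHh]]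
  |f h Ef [f' [Hf' IHf]] Eh [h' [Hh' IHh]]|f Ef [f' [Hf' IHf]] Hf|f Ef [f' [Hf' IHf]] Hf].
- exists (fun _ => 0); split; [constructor|].
  intros p; exact (is_derive_const _ _).
- exists (fun _ => if match i, j with I0, I0 | I1, I1 | I2, I2 => true | _, _ => false end
                   then 1 else 0).
  split; [constructor|].
  intros [[a b] c]; destruct i, j; cbn;
    (exact (is_derive_const _ _) || exact (is_derive_id _)).
- exists (fun p => f' p + h' p); split; [now constructor|].
  intros p; exact (is_derive_plus _ _ _ _ _ (IHf p) (IHh p)).
- exists (fun p => f' p * h p + f p * h' p); split; [now repeat constructor|].
  intros p; evar_last;
    [exact (is_derive_mult _ _ _ _ _ (IHf p) (IHh p) Rmult_comm) |].
  cbn; now rewrite upd_coord.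
- exists (fun p => (-1) * (f' p * (/ f p * / f p))); split.
  { repeat constructor; auto. }
  intros p; evar_last;
    [exact (is_derive_inv _ _ _ (IHf p) (Hf _)) |].
  cbn; rewrite upd_coord; field; apply Hf.
- exists (fun p => f' p * / (2 * sqrt (f p))); split.
  { repeat constructor; auto.
    intros p; pose proof (sqrt_lt_R0 _ (Hf p)); lra. }
  intros p; evar_last;
    [exact (is_derive_sqrt _ _ _ (IHf p) (Hf _)) |].
  cbn; now rewrite upd_coord.
Qed.

Lemma elementary_smooth f : elementary f -> smooth f.
Proof.
intros Hf l.
assert (Hl : elementary (iter_pd l f)).
{ induction l as [|i l IH]; [exact Hf | now apply elementary_pd]. }
intros p; split; [intros i; now apply elementary_pd | now apply elementary_continuous].
Qed.

(** * Curvature of the double in stereographic coordinates *)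

Definition stereo_den (a b : R) : R := 1 + a ^ 2 + b ^ 2.

Lemma area_radius_pos m x : 0 < m -> 0 < area_radius m x.
Proof. intros; unfold area_radius; nra. Qed.

Lemma tensor2_ext (h k : tensor2) :
  (forall i j x a b, h i j (x, a, b) = k i j (x, a, b)) -> h = k.
Proof.
intros E; apply functional_extensionality; intros i.
apply functional_extensionality; intros j.
apply functional_extensionality; intros [[x a] b]; apply E.
Qed.

(** The bilinear form P dx^2 + (Q/4) ds^2_{S^2}, since in stereographic coordinates
    the round metric is 4 / S^2 times the Euclidean one. *)
Definition spherical (P Q : R -> R) : tensor2 := fun i j p =>
  match p with (x, a, b) =>
    match i, j with
    | I0, I0 => P x
    | I1, I1 | I2, I2 => Q x / stereo_den a b ^ 2
    | _, _ => 0
    end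
  end.

Ltac nonzero :=
  unfold area_radius, stereo_den in *; repeat split; try assumption;
  repeat (apply Rmult_integral_contrapositive_currified || apply pow_nonzero);
  try exact I; try (apply Rgt_not_eq; nra).

Ltac compute_derive :=
  repeat match goal with
  | |- context [Derive ?f ?x] =>
     rewrite (is_derive_unique f x _
       ltac:(auto_derive; [nonzero | reflexivity]))
  end.

Ltac compute_pd :=
  unfold pd, spherical, stereo_den, area_radius; cbn [upd coord];
  compute_derive.

Section Curvature.
Variable m : R.
Hypothesis hm : 0 < m.
Local Notation r := (area_radius m).

Definition double_chart : tensor2 := spherical (fun x => 4 * r x) (fun x => 4 * r x ^ 2).

Lemma metric_in_chart_double c :
  metric_in_chart c (double_schwarzschild m) = double_chart.
Proof.
apply tensor2_ext; intros i j x a b.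
destruct c, i, j; unfold metric_in_chart, frame, pd; cbn [upd coord];
unfold double_schwarzschild, stereo, dot, sum3; cbn [fst snd coord];
compute_derive;
unfold double_chart, spherical, stereo_den, area_radius; field; nonzero.
Qed.

Definition double_chart_inv : tensor2 := fun i j p => match p with (x, a, b) =>
  match i, j with
  | I0, I0 => / (4 * r x)
  | I1, I1 | I2, I2 => stereo_den a b ^ 2 / (4 * r x ^ 2)
  | _, _ => 0
  end end.

Lemma ginv_double : ginv double_chart = double_chart_inv.
Proof.
apply tensor2_ext; intros i j x a b.
destruct i, j; unfold ginv, det3, cofactor, sum3, double_chart, double_chart_inv, spherical;
cbn; unfold stereo_den, area_radius; field; nonzero.
Qed.

Definition double_christoffel (k i j : idx) (p : V3) : R := match p with (x, a, b) =>
  match k, i, j with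
  | I0, I0, I0 => x / r x
  | I0, I1, I1 | I0, I2, I2 => - (2 * x) / stereo_den a b ^ 2
  | I1, I0, I1 | I1, I1, I0 | I2, I0, I2 | I2, I2, I0 => 2 * x / r x
  | I1, I1, I1 | I2, I1, I2 | I2, I2, I1 => - (2 * a) / stereo_den a b
  | I1, I2, I2 => 2 * a / stereo_den a b
  | I2, I2, I2 | I1, I1, I2 | I1, I2, I1 => - (2 * b) / stereo_den a b
  | I2, I1, I1 => 2 * b / stereo_den a b
  | _, _, _ => 0
  end end.

Lemma christoffel_double : christoffel double_chart = double_christoffel.
Proof.
apply functional_extensionality; intros k; apply tensor2_ext; intros i j x a b.
unfold christoffel, sum3; rewrite ginv_double.
destruct k, i, j; unfold double_chart_inv, double_christoffel, double_chart;
compute_pd; field; nonzero.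
Qed.

(** Sectional curvature of the coordinate plane spanned by d_i and d_j. *)
Definition sectional (i j : idx) (x : R) : R :=
  match i, j with
  | I0, I0 | I1, I1 | I2, I2 => 0
  | I1, I2 | I2, I1 => 2 * m / r x ^ 3
  | _, _ => - m / r x ^ 3
  end.

(** Only the components with equal outer indices enter the Ricci tensor and the
    curvature action.  They vanish off the diagonal j = k because the
    curvature operator is diagonal in the coordinate planes. *)
Lemma riem_double a j k p :
  riem double_chart a j k a p = sectional a j (coord I0 p) * double_chart j k p.
Proof.
destruct p as [[x y] z].
unfold riem, sum3; rewrite christoffel_double.
destruct a, j, k; unfold double_christoffel, double_chart, sectional;
compute_pd; field; nonzero.
Qed.

Definition double_ric : tensor2 :=
  spherical (fun x => - 8 * m / r x ^ 2) (fun x => 4 * m / r x).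

Lemma ric_double : ric double_chart = double_ric.
Proof.
apply tensor2_ext; intros i j x a b.
unfold ric, sum3; rewrite !riem_double.
destruct i, j;
unfold double_ric, double_chart, sectional, spherical, area_radius, stereo_den;
cbn [coord]; field; nonzero.
Qed.

Lemma trace2_double h p : trace2 double_chart h p =
  h I0 I0 p * double_chart_inv I0 I0 p + (h I1 I1 p + h I2 I2 p) * double_chart_inv I1 I1 p.
Proof.
unfold trace2, sum3; rewrite ginv_double; destruct p as [[x a] b]; cbn; ring.
Qed.

Lemma scalar_curv_double p : scalar_curv double_chart p = 0.
Proof.
unfold scalar_curv; rewrite trace2_double, ric_double; destruct p as [[x a] b].
unfold double_ric, double_chart_inv, spherical, area_radius, stereo_den; field; nonzero.
Qed.

Lemma normsq2_ric_double x a b :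
  normsq2 double_chart (ric double_chart) (x, a, b) = 6 * m ^ 2 / r x ^ 6.
Proof.
unfold normsq2, sum3; rewrite ginv_double, ric_double.
unfold double_ric, double_chart_inv, spherical, area_radius, stereo_den; field; nonzero.
Qed.

(** Totally symmetric in its three indices, as the Codazzi equation predicts for
    a scalar-flat conformally flat metric. *)
Definition double_cov_ric (k i j : idx) (p : V3) : R := match p with (x, a, b) =>
  match k, i, j with
  | I0, I0, I0 => 48 * m * x / r x ^ 3
  | I0, I1, I1 | I1, I0, I1 | I1, I1, I0 | I0, I2, I2 | I2, I0, I2 | I2, I2, I0 =>
     - 24 * m * x / (r x ^ 2 * stereo_den a b ^ 2)
  | _, _, _ => 0
  end end.

Lemma cov2_ric_double : cov2 double_chart (ric double_chart) = double_cov_ric.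
Proof.
apply functional_extensionality; intros k; apply tensor2_ext; intros i j x a b.
unfold cov2, sum3; rewrite ric_double, christoffel_double.
destruct k, i, j; unfold double_christoffel, double_ric, double_cov_ric;
compute_pd; field; nonzero.
Qed.

(** The second derivative of Ric is computed only on the diagonal l = k, which is
    all that the inverse metric sees. *)
Lemma rough_laplacian_double i j : rough_laplacian double_chart (ric double_chart) i j =
  spherical (fun x => - 24 * m ^ 2 / r x ^ 5) (fun x => 12 * m ^ 2 / r x ^ 4) i j.
Proof.
apply functional_extensionality; intros [[x a] b].
transitivity (- sum3 (fun l => double_chart_inv l l (x, a, b)
  * cov22 double_chart (ric double_chart) l l i j (x, a, b))).
{ unfold rough_laplacian, sum3; rewrite ginv_double; cbn; ring. }
unfold cov22, sum3; rewrite christoffel_double, cov2_ric_double.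
destruct i, j; unfold double_christoffel, double_cov_ric, double_chart_inv;
compute_pd; field; nonzero.
Qed.

Lemma curv_action_double i j p :
  curv_action double_chart (ric double_chart) i j p =
  spherical (fun x => - 8 * m ^ 2 / r x ^ 5) (fun x => 16 * m ^ 2 / r x ^ 4) i j p.
Proof.
transitivity
  (sum3 (fun a => double_chart_inv a a p * riem double_chart a i j a p * double_ric a a p)).
{ unfold curv_action, sum3; rewrite ginv_double, ric_double.
  destruct p as [[x a] b]; cbn; ring. }
unfold sum3; rewrite !riem_double; destruct p as [[x a] b].
destruct i, j;
  unfold double_chart_inv, double_ric, double_chart, sectional, spherical, area_radius,
    stereo_den; cbn [coord]; field; nonzero.
Qed.

Definition radial_hess (f1 f2 : R -> R) : tensor2 :=
  spherical (fun x => f2 x - x / r x * f1 x) (fun x => 2 * x * f1 x).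

Lemma hess_radial_double f f1 f2 i j p :
  (forall x, is_derive f x (f1 x)) -> (forall x, is_derive f1 x (f2 x)) ->
  hess double_chart (fun q => f (coord I0 q)) i j p = radial_hess f1 f2 i j p.
Proof.
intros H1 H2; destruct p as [[x a] b].
assert (E : forall k, pd k (fun q => f (coord I0 q))
            = fun q => match k with I0 => f1 (coord I0 q) | _ => 0 end).
{ intros k; apply functional_extensionality; intros [[x' a'] b'].
  destruct k; unfold pd; cbn; try apply Derive_const.
  apply is_derive_unique, H1. }
assert (E2 : pd i (pd j (fun q => f (coord I0 q))) (x, a, b)
  = match i, j with I0, I0 => f2 x | _, _ => 0 end).
{ rewrite E; destruct i, j; unfold pd; cbn; try apply Derive_const.
  apply is_derive_unique, H2. }
unfold hess, sum3; rewrite E2, !E, christoffel_double.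
destruct i, j; unfold radial_hess, double_christoffel, spherical, area_radius, stereo_den;
  cbn [coord]; field; nonzero.
Qed.

Lemma grad_R2_double i j p : grad_R2 double_chart i j p =
  spherical (fun x => 4 * m ^ 2 / r x ^ 5) (fun x => - 8 * m ^ 2 / r x ^ 4) i j p.
Proof.
destruct p as [[x a] b].
assert (E : scalar_curv double_chart = (fun q => (fun _ => 0) (coord I0 q))).
{ apply functional_extensionality; intros q; apply scalar_curv_double. }
unfold grad_R2, laplacian.
rewrite rough_laplacian_double, curv_action_double, normsq2_ric_double, trace2_double, E.
rewrite !(hess_radial_double (fun _ => 0) (fun _ => 0) (fun _ => 0))
  by (intros; exact (is_derive_const _ _)).
destruct i, j;
  unfold radial_hess, double_chart_inv, double_chart, spherical, area_radius, stereo_den;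
  field; nonzero.
Qed.
End Curvature.

(** * The double is a Riemannian metric *)

Section Metric.
Variable m : R.
Hypothesis hm : 0 < m.

Lemma elementary_radius : elementary (fun q => area_radius m (coord I0 q)).
Proof.
replace (fun q => area_radius m (coord I0 q)) with
  (fun q => 2 * m + coord I0 q * coord I0 q)
  by (apply functional_extensionality; intros q; unfold area_radius; ring).
repeat constructor.
Qed.

Lemma elementary_double i j : elementary (double_chart m i j).
Proof.
assert (H0 : elementary (fun _ => 0)) by constructor.
pose proof elementary_radius as Hr.
set (S := fun p => 1 + (coord I1 p * coord I1 p + coord I2 p * coord I2 p)).
assert (HS : elementary (fun p => / S p)).
{ repeat constructor; intros p; unfold S; nra. }
assert (H00 : elementary (double_chart m I0 I0)).
{ replace (double_chart m I0 I0) with (fun p => 4 * area_radius m (coord I0 p)).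
  - repeat (assumption || constructor).
  - apply functional_extensionality; intros [[x a] b]; reflexivity. }
assert (H11 : elementary (double_chart m I1 I1)).
{ replace (double_chart m I1 I1) with (fun p =>
    4 * (area_radius m (coord I0 p) * area_radius m (coord I0 p)) * (/ S p * / S p)).
  - repeat (assumption || constructor).
  - apply functional_extensionality; intros [[x a] b].
    unfold S, double_chart, spherical, stereo_den; cbn [coord].
    unfold area_radius; field; nonzero. }
destruct i, j; try exact H00; try exact H11;
  match goal with |- elementary ?f => replace f with (fun _ : V3 => 0) end;
  try exact H0; apply functional_extensionality; intros [[x a] b]; reflexivity.
Qed.

Lemma dot_self_ge0 v : 0 <= dot v v.
Proof. unfold dot, sum3; nra. Qed.

Definition euclidean_sq (v : RV3) : R := fst v ^ 2 + dot (snd v) (snd v).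

Lemma euclidean_sq_pos v : v <> zero -> 0 < euclidean_sq v.
Proof.
destruct v as [v0 [[v1 v2] v3]]; intros Hv.
unfold euclidean_sq, dot, sum3; cbn [fst snd coord].
destruct (Rlt_le_dec 0 (v0 ^ 2 + (v1 * v1 + v2 * v2 + v3 * v3))) as [H|H]; [exact H|].
exfalso; apply Hv.
replace v0 with 0 by nra; replace v1 with 0 by nra.
replace v2 with 0 by nra; replace v3 with 0 by nra; reflexivity.
Qed.

(** The infimum of 4r and r^2 over r >= 2m: the factor by which the double
    dominates the Euclidean metric. *)
Definition comparison : R := Rmin (8 * m) ((2 * m) ^ 2).

Lemma comparison_pos : 0 < comparison.
Proof. apply Rmin_glb_lt; nra. Qed.

Lemma double_ge_euclidean p v :
  comparison * euclidean_sq v <= double_schwarzschild m p v v.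
Proof.
pose proof (Rmin_l (8 * m) ((2 * m) ^ 2)); pose proof (Rmin_r (8 * m) ((2 * m) ^ 2)).
fold comparison in *.
pose proof (dot_self_ge0 (snd v)).
assert (Hr : 2 * m <= area_radius m (fst p)) by (unfold area_radius; nra).
unfold euclidean_sq, double_schwarzschild.
rewrite Rmult_plus_distr_l; apply Rplus_le_compat.
- replace (fst v * fst v) with (fst v ^ 2) by ring; apply Rmult_le_compat_r; nra.
- apply Rmult_le_compat_r; nra.
Qed.

Lemma double_riemannian : riemannian (double_schwarzschild m).
Proof.
split; [|split; [|split]].
- intros [x [[y0 y1] y2]] [u0 [[u1 u2] u3]] [v0 [[v1 v2] v3]] [w0 [[w1 w2] w3]] a _ _ _ _.
  unfold double_schwarzschild, dot, sum3, plus, scal; cbn; unfold mult, plus; cbn; ring.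
- intros p v w _ _ _; unfold double_schwarzschild, dot, sum3; ring.
- intros p v _ _ Hv.
  eapply Rlt_le_trans; [|apply double_ge_euclidean].
  apply Rmult_lt_0_compat; [apply comparison_pos | now apply euclidean_sq_pos].
- intros c i j; rewrite metric_in_chart_double by exact hm.
  apply elementary_smooth, elementary_double.
Qed.

Lemma double_doubles_schwarzschild :
  doubles_schwarzschild m (area_radius m) (double_schwarzschild m).
Proof.
unfold doubles_schwarzschild.
repeat match goal with |- _ /\ _ => split end.
- unfold area_radius; ring.
- intros x; unfold area_radius; ring.
- intros x x' H; unfold area_radius; nra.
- intros s Hs; exists (sqrt (s - 2 * m)); split; [apply sqrt_pos|].
  unfold area_radius; simpl; rewrite Rmult_1_r, sqrt_sqrt; lra.
- intros p v w _ _ _; unfold double_schwarzschild, reflect; cbn [fst snd].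
  unfold area_radius; ring.
- intros p v w _ _ _ Hp.
  assert (D : is_derive (area_radius m) (fst p) (2 * fst p)).
  { unfold area_radius; auto_derive; [exact I | simpl; ring]. }
  split; [now exists (2 * fst p)|].
  rewrite (is_derive_unique _ _ _ D).
  unfold double_schwarzschild, schwarzschild; cbn [fst snd].
  unfold area_radius; field; split; [|nonzero].
  intros E; apply Hp; nra.
Qed.
End Metric.

(** * Completeness *)

(** [None] indexes the R-factor, [Some i] the coordinates of R^3: one index type
    lets the four components be treated alike. *)
Definition component (o : option idx) (v : RV3) : R :=
  match o with None => fst v | Some i => coord i (snd v) end.

Lemma continuous_component o p : continuous (component o : RV3 -> R) p.
Proof.
destruct o as [i|]; cbn.
- apply (continuous_comp snd (coord i)); [apply continuous_snd | apply continuous_coord].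
- apply continuous_fst.
Qed.

Lemma is_derive_component o (gam : R -> RV3) t l :
  is_derive gam t l -> is_derive (fun t => component o (gam t)) t (component o l).
Proof.
intros H.
assert (L : is_linear (component o : RV3 -> R)).
{ destruct o as [i|].
  - apply (is_linear_comp (fun v : RV3 => snd v) (fun y : V3 => coord i y)).
    + apply is_linear_snd.
    + destruct i.
      * eapply (is_linear_ext (fun y : V3 => fst (fst y))).
        { intros [[a b] c]; reflexivity. }
        apply (is_linear_comp fst fst); apply is_linear_fst.
      * eapply (is_linear_ext (fun y : V3 => snd (fst y))).
        { intros [[a b] c]; reflexivity. }
        apply (is_linear_comp fst snd); [apply is_linear_fst | apply is_linear_snd].
      * eapply (is_linear_ext (fun y : V3 => snd y)).
        { intros [[a b] c]; reflexivity. }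
        apply is_linear_snd.
  - apply is_linear_fst. }
eapply filterdiff_ext_lin.
- eapply (filterdiff_comp' gam (component o : RV3 -> R)); [exact H|].
  apply filterdiff_linear, L.
- intros y; cbn. apply (linear_scal _ L).
Qed.

Definition of_components (f : option idx -> R -> R) (t : R) : RV3 :=
  (f None t, (f (Some I0) t, f (Some I1) t, f (Some I2) t)).

Lemma is_derive_of_components f f' t : (forall o, is_derive (f o) t (f' o t)) ->
  is_derive (of_components f) t (of_components f' t).
Proof.
intros H.
set (e := fun o : option idx => match o with
  | None => (1, (0, 0, 0)) | Some I0 => (0, (1, 0, 0))
  | Some I1 => (0, (0, 1, 0)) | Some I2 => (0, (0, 0, 1)) end : RV3).
assert (E : forall g : option idx -> R -> R, forall s, of_components g s =
  plus (scal (g None s) (e None)) (plus (scal (g (Some I0) s) (e (Some I0)))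
   (plus (scal (g (Some I1) s) (e (Some I1))) (scal (g (Some I2) s) (e (Some I2)))))).
{ intros g s; unfold of_components, e.
  repeat apply injective_projections; cbn; unfold mult; cbn; ring. }
rewrite E; eapply is_derive_ext; [intros s; symmetry; apply E|].
repeat apply @is_derive_plus; apply @is_derive_scal_l, H.
Qed.

Lemma continuous_of_components f t : (forall o, continuous (f o) t) ->
  continuous (of_components f) t.
Proof.
intros H P [eps HP].
assert (B : forall o, locally t (fun s => ball (f o t) eps (f o s))).
{ intros o; apply H; now exists eps. }
change (locally t (fun s => P (of_components f s))).
generalize (filter_and _ _ (B None) (filter_and _ _ (B (Some I0))
  (filter_and _ _ (B (Some I1)) (B (Some I2))))).
apply filter_imp; intros s (H0 & H1 & H2 & H3); apply HP; repeat split; assumption.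
Qed.

Section Complete.
Variable m : R.
Hypothesis hm : 0 < m.
Local Notation g := (double_schwarzschild m).

Definition speed (gam dgam : R -> RV3) (t : R) : R :=
  sqrt (g (gam t) (dgam t) (dgam t)).

Lemma continuous_speed gam dgam t : continuous gam t -> continuous dgam t ->
  continuous (speed gam dgam) t.
Proof.
intros Hg Hd.
assert (C : forall (c : R -> RV3) o, continuous c t ->
    continuous (fun t => component o (c t)) t).
{ intros c o Hc; apply (continuous_comp c (component o));
    [exact Hc | apply continuous_component]. }
assert (Hx := C gam None Hg).
assert (Hr : continuous (fun t => area_radius m (fst (gam t))) t).
{ apply (continuous_comp _ (area_radius m) _ Hx).
  apply (ex_derive_continuous (V := R_NormedModule)).
  unfold area_radius; auto_derive; exact I. }
apply continuous_sqrt_comp; unfold double_schwarzschild, dot, sum3.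
repeat first
 [ apply (C dgam None Hd) | apply (C dgam (Some I0) Hd) | apply (C dgam (Some I1) Hd)
 | apply (C dgam (Some I2) Hd) | apply Hr | apply continuous_const
 | apply @continuous_plus | apply @continuous_mult | idtac ].
Qed.

(** Each Euclidean component is Lipschitz for the Riemannian distance, since the
    speed of a curve is at least sqrt(comparison) times the speed of any of its
    components. *)
Lemma component_dist o p q eps : dist_lt g p q eps ->
  sqrt (comparison m) * Rabs (component o q - component o p) < eps.
Proof.
intros (gam & dgam & Hd & _ & H0 & H1 & HL).
assert (Hc : forall t, continuous gam t).
{ intros t; exact (ex_derive_continuous _ _ (ex_intro _ _ (proj1 (Hd t)))). }
assert (HI : is_RInt (fun t => component o (dgam t)) 0 1 (component o q - component o p)).
{ rewrite <- H0, <- H1.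
  apply (is_RInt_derive (fun t => component o (gam t))); intros t _.
  - now apply is_derive_component, Hd.
  - apply (continuous_comp dgam (component o)); [apply Hd | apply continuous_component]. }
assert (HS : ex_RInt (speed gam dgam) 0 1).
{ apply (ex_RInt_continuous (V := R_CompleteNormedModule)); intros t _.
  apply continuous_speed; [apply Hc | apply Hd]. }
apply (RInt_correct (V := R_CompleteNormedModule)) in HS.
eapply Rle_lt_trans; [|exact HL].
assert (Hsc := is_RInt_scal _ _ _ (sqrt (comparison m)) _ HI).
replace (sqrt (comparison m) * Rabs (component o q - component o p))
  with (Rabs (sqrt (comparison m) * (component o q - component o p)))
  by (rewrite Rabs_mult, Rabs_pos_eq; [ring | apply sqrt_pos]).
refine (norm_RInt_le _ (speed gam dgam) 0 1 _ _ Rle_0_1 _ Hsc HS).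
intros t _; change (Rabs (sqrt (comparison m) * component o (dgam t)) <= speed gam dgam t).
rewrite <- sqrt_Rsqr_abs; apply sqrt_le_1_alt.
eapply Rle_trans; [|exact (double_ge_euclidean m hm _ _)].
rewrite Rsqr_mult, Rsqr_sqrt by (apply Rlt_le, comparison_pos, hm).
apply Rmult_le_compat_l; [apply Rlt_le, comparison_pos, hm|].
unfold Rsqr, euclidean_sq, dot, sum3, component; destruct o as [[]|]; nra.
Qed.

(** Let Y = q + t w, w = p - q, be the chord in R^3 between the sphere factors and
    D = |w|^2.  Both ends being unit vectors, the inner product of q and w is -D/2
    and |Y|^2 = 1 - tD + t^2 D >= 1 - D/4, so for D < 1 the curve Y/|Y| exists for
    all t, and its speed is at most |w|/|Y|.  The R-factor moves linearly, which
    keeps r bounded by r1 along the curve. *)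
Lemma short_curve p eps : on_N p -> 0 < eps -> exists delta, 0 < delta /\
  forall q, on_N q -> (forall o, Rabs (component o q - component o p) < delta) ->
  dist_lt g q p eps.
Proof.
intros Hp Heps.
set (r1 := 2 * m + (Rabs (fst p) + 1) ^ 2).
set (M := sqrt (4 * r1 + 6 * r1 ^ 2)).
assert (HM : 0 <= M) by apply sqrt_pos.
exists (Rmin (/ 2) (eps / (M + 1))); split.
{ apply Rmin_glb_lt; [lra | apply Rdiv_lt_0_compat; lra]. }
intros q Hq Hpq.
set (delta := Rmin _ _) in Hpq.
assert (Hd1 : delta <= / 2) by apply Rmin_l.
assert (Hd2 : delta * M < eps).
{ apply Rle_lt_trans with (eps / (M + 1) * M).
  - apply Rmult_le_compat_r; [exact HM | apply Rmin_r].
  - apply (Rmult_lt_reg_r (M + 1)); [lra|].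
    replace (eps / (M + 1) * M * (M + 1)) with (eps * M) by (field; lra); nra. }
assert (Hsq : forall o, (component o p - component o q) ^ 2 <= delta ^ 2).
{ intros o; specialize (Hpq o); rewrite Rabs_minus_sym in Hpq.
  apply pow_maj_Rabs. lra. }
set (w := fun o => component o p - component o q) in *.
set (Y := fun i t => component (Some i) q + t * w (Some i)).
set (D := sum3 (fun i => w (Some i) ^ 2)).
(* |Y|^2 *)
set (N2 := fun t => 1 - t * D + t ^ 2 * D).
assert (Hqq : sum3 (fun i => component (Some i) q ^ 2) = 1).
{ rewrite <- Hq; unfold dot, sum3, component; ring. }
assert (Hqw : sum3 (fun i => component (Some i) q * w (Some i)) = - D / 2).
{ assert (Hpp : sum3 (fun i => component (Some i) p ^ 2) = 1).
  { rewrite <- Hp; unfold dot, sum3, component; ring. }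
  unfold D, w, sum3 in *; lra. }
assert (HY : forall t, sum3 (fun i => Y i t ^ 2) = N2 t).
{ intros t; unfold N2.
  transitivity (sum3 (fun i => component (Some i) q ^ 2)
    + 2 * t * sum3 (fun i => component (Some i) q * w (Some i)) + t ^ 2 * D).
  - unfold Y, D, sum3; ring.
  - rewrite Hqq, Hqw; field. }
assert (HD : 0 <= D <= 3 * delta ^ 2).
{ unfold D, sum3, w; split.
  - repeat apply Rplus_le_le_0_compat; apply pow2_ge_0.
  - pose proof (Hsq (Some I0)); pose proof (Hsq (Some I1)); pose proof (Hsq (Some I2)).
    lra. }
assert (Hd0 : 0 < delta) by exact (Rle_lt_trans _ _ _ (Rabs_pos _) (Hpq None)).
assert (Hdd : delta ^ 2 <= / 4) by nra.
(* the inner product of Y and w, half the derivative of |Y|^2 *)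
set (H := fun t => D * (t - / 2)).
assert (HYw : forall t, sum3 (fun i => Y i t * w (Some i)) = H t).
{ intros t; transitivity (sum3 (fun i => component (Some i) q * w (Some i)) + t * D).
  - unfold Y, D, sum3; ring.
  - rewrite Hqw; unfold H; field. }
assert (HN2 : forall t, 3 / 4 <= N2 t)
  by (intros t; unfold N2; pose proof (pow2_ge_0 (t - / 2)); nra).
(* 1/|Y| *)
set (s := fun t => / sqrt (N2 t)).
assert (Hs : forall t, 0 < s t /\ s t ^ 2 * N2 t = 1).
{ intros t; specialize (HN2 t).
  assert (0 < sqrt (N2 t)) by (apply sqrt_lt_R0; lra).
  split; [now apply Rinv_0_lt_compat|].
  pose proof (sqrt_sqrt (N2 t) ltac:(lra)) as E; unfold s.
  set (k := sqrt (N2 t)) in *; rewrite <- E; field; lra. }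
set (gam := fun (o : option idx) t => match o with
  | None => component None q + t * w None
  | Some i => Y i t * s t end).
set (dgam := fun (o : option idx) t => match o with
  | None => w None
  | Some i => w (Some i) * s t - Y i t * (H t * s t ^ 3) end).
assert (Hds : forall t, is_derive s t (- (H t * s t ^ 3))).
{ intros t; specialize (HN2 t).
  assert (Hpos : 0 < sqrt (N2 t)) by (apply sqrt_lt_R0; lra).
  assert (HdN : is_derive N2 t (2 * H t)).
  { unfold N2, H; auto_derive; [exact I | field]. }
  evar_last;
    [exact (is_derive_inv _ _ _ (is_derive_sqrt _ _ _ HdN ltac:(lra)) ltac:(lra)) |].
  unfold s; field; lra. }
assert (HdY : forall i t, is_derive (Y i) t (w (Some i))).
{ intros i t; unfold Y; auto_derive; [exact I | ring]. }
assert (Hgam : forall o t, is_derive (gam o) t (dgam o t)).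
{ intros [i|] t; unfold gam, dgam.
  - evar_last; [exact (is_derive_mult _ _ _ _ _ (HdY i t) (Hds t) Rmult_comm)|].
    change (w (Some i) * s t + Y i t * - (H t * s t ^ 3)
            = w (Some i) * s t - Y i t * (H t * s t ^ 3)); ring.
  - auto_derive; [exact I | ring]. }
assert (Hdgam : forall o t, continuous (dgam o) t).
{ intros [i|] t; unfold dgam; [|apply continuous_const].
  apply (ex_derive_continuous (V := R_NormedModule)); unfold Y, H.
  auto_derive; repeat split; eexists; apply Hds. }
exists (of_components gam), (of_components dgam).
split; [|split; [|split; [|split]]].
{ intros t; split.
  - apply is_derive_of_components; intros o; apply Hgam.
  - apply continuous_of_components; intros o; apply Hdgam. }
{ intros t _. specialize (HY t). destruct (Hs t) as [_ Hst].
  unfold on_N, on_S2, dot, sum3, of_components, gam in *; cbn [snd coord fst].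
  rewrite <- Hst, <- HY; ring. }
{ assert (E : s 0 = 1).
  { unfold s, N2; replace (1 - 0 * D + 0 ^ 2 * D) with 1 by ring.
    now rewrite sqrt_1, Rinv_1. }
  unfold of_components, gam, Y; rewrite E; destruct q as [x [[a b] c]].
  repeat apply injective_projections; cbn; ring. }
{ assert (E : s 1 = 1).
  { unfold s, N2; replace (1 - 1 * D + 1 ^ 2 * D) with 1 by ring.
    now rewrite sqrt_1, Rinv_1. }
  unfold of_components, gam, Y, w; rewrite E; destruct p as [x [[a b] c]].
  repeat apply injective_projections; cbn; ring. }
assert (Hspeed : forall t, 0 <= t <= 1 ->
  speed (of_components gam) (of_components dgam) t <= delta * M).
{ intros t Ht.
  assert (Hrad : area_radius m (fst (of_components gam t)) <= r1).
  { unfold area_radius, r1, of_components, gam; cbn [fst].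
    apply Rplus_le_compat_l, pow_maj_Rabs.
    replace (component None q + t * w None)
      with (fst p + (1 - t) * (component None q - component None p))
      by (unfold w, component; ring).
    eapply Rle_trans; [apply Rabs_triang|].
    apply Rplus_le_compat_l; rewrite Rabs_mult, (Rabs_pos_eq (1 - t)) by lra.
    pose proof (Hpq None); pose proof (Rabs_pos (component None q - component None p)).
    nra. }
  (* with s^2 |Y|^2 = 1 the squared speed of Y/|Y| is D s^2 - H^2 s^4 *)
  assert (Hsph : dot (snd (of_components dgam t)) (snd (of_components dgam t))
                 <= 6 * delta ^ 2).
  { specialize (HY t); specialize (HYw t); specialize (HN2 t).
    destruct (Hs t) as [Hst HsN].
    replace (dot _ _) with (D * s t ^ 2 - H t ^ 2 * s t ^ 4).
    - pose proof (pow2_ge_0 (H t * s t ^ 2)); nra.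
    - replace (D * s t ^ 2 - H t ^ 2 * s t ^ 4)
        with (D * s t ^ 2 - 2 * H t * s t ^ 4 * sum3 (fun i => Y i t * w (Some i))
              + H t ^ 2 * s t ^ 6 * sum3 (fun i => Y i t ^ 2)).
      + unfold D, dot, sum3, of_components, dgam; cbn [fst snd coord]; ring.
      + rewrite HY, HYw.
        replace (H t ^ 2 * s t ^ 6 * N2 t)
          with (H t ^ 2 * s t ^ 4 * (s t ^ 2 * N2 t)) by ring.
        rewrite HsN; ring. }
  assert (Hr0 : 0 < area_radius m (fst (of_components gam t)))
    by (apply area_radius_pos, hm).
  assert (Hr2 : 0 <= area_radius m (fst (of_components gam t)) ^ 2 <= r1 ^ 2) by nra.
  replace (delta * M) with (sqrt (delta ^ 2 * (4 * r1 + 6 * r1 ^ 2))).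
  2: { rewrite sqrt_mult_alt, sqrt_pow2 by nra; reflexivity. }
  apply sqrt_le_1_alt; unfold double_schwarzschild.
  assert (Hx : fst (of_components dgam t) * fst (of_components dgam t) <= delta ^ 2).
  { pose proof (Hsq None) as Hx; unfold of_components, dgam; cbn [fst]; unfold w; lra. }
  assert (0 <= fst (of_components dgam t) * fst (of_components dgam t)) by nra.
  pose proof (dot_self_ge0 (snd (of_components dgam t))).
  replace (delta ^ 2 * (4 * r1 + 6 * r1 ^ 2))
    with (4 * r1 * delta ^ 2 + r1 ^ 2 * (6 * delta ^ 2)) by ring.
  apply Rplus_le_compat; apply Rmult_le_compat; lra. }
change (RInt (speed (of_components gam) (of_components dgam)) 0 1 < eps).
eapply Rle_lt_trans; [apply Rle_abs|].
eapply Rle_lt_trans; [apply (abs_RInt_le_const _ 0 1 (delta * M)); [lra | | ] | lra].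
- apply (ex_RInt_continuous (V := R_CompleteNormedModule)); intros t _.
  apply continuous_speed; apply continuous_of_components; intros o; [|apply Hdgam].
  apply (ex_derive_continuous (V := R_NormedModule)); eexists; apply Hgam.
- intros t Ht; rewrite Rabs_pos_eq by apply sqrt_pos; now apply Hspeed.
Qed.

Lemma double_complete : complete_metric g.
Proof.
intros s Hs HC.
pose proof (sqrt_lt_R0 _ (comparison_pos m hm)) as Hk.
assert (HL : forall o, exists l : R, is_lim_seq (fun n => component o (s n)) l).
{ intros o; apply ex_lim_seq_cauchy_corr; intros eps.
  destruct (HC (sqrt (comparison m) * eps)) as [n0 Hn0].
  { apply Rmult_lt_0_compat; [exact Hk | apply cond_pos]. }
  exists n0; intros n k Hn Hk'.
  apply (Rmult_lt_reg_l (sqrt (comparison m))); [exact Hk|].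
  now apply (component_dist o (s k) (s n)), Hn0. }
destruct (HL None) as [l Hl]; destruct (HL (Some I0)) as [l0 Hl0].
destruct (HL (Some I1)) as [l1 Hl1]; destruct (HL (Some I2)) as [l2 Hl2].
set (p := (l, (l0, l1, l2)) : RV3).
assert (Hp : on_N p).
{ apply Rbar_finite_eq.
  rewrite <- (Lim_seq_const 1); symmetry; apply is_lim_seq_unique.
  apply (is_lim_seq_ext (fun n => dot (snd (s n)) (snd (s n)))); [exact Hs|].
  repeat apply is_lim_seq_plus'; apply is_lim_seq_mult'; assumption. }
exists p; split; [exact Hp|].
intros eps Heps; destruct (short_curve p eps Hp Heps) as (delta & Hdelta & Hsh).
assert (HE : forall o, eventually
  (fun n => Rabs (component o (s n) - component o p) < delta)).
{ intros o; assert (Ho : is_lim_seq (fun n => component o (s n)) (component o p))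
    by (destruct o as [[]|]; assumption).
  apply is_lim_seq_spec in Ho; exact (Ho (mkposreal delta Hdelta)). }
destruct (filter_and _ _ (HE None) (filter_and _ _ (HE (Some I0))
  (filter_and _ _ (HE (Some I1)) (HE (Some I2))))) as [n0 Hn0].
exists n0; intros n Hn; apply Hsh; [apply Hs|].
destruct (Hn0 n Hn) as (H0 & H1 & H2 & H3).
intros [[]|]; assumption.
Qed.
End Complete.

(** * The potential and the field equations *)

Section Potential.
Variable m : R.
Hypothesis hm : 0 < m.
Local Notation r := (area_radius m).

(** The odd extension of u is x / sqrt r, which is smooth at x = 0. *)
Lemma u_pot_eq p : u_pot m p = fst p * / sqrt (r (fst p)).
Proof.
pose proof (area_radius_pos m (fst p) hm) as Hr.
unfold u_pot; replace (1 - 2 * m / r (fst p)) with (fst p ^ 2 / r (fst p))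
  by (unfold area_radius in *; field; lra).
rewrite sqrt_div_alt by exact Hr.
replace (fst p ^ 2) with (Rsqr (fst p)) by (unfold Rsqr; ring).
rewrite sqrt_Rsqr_abs; unfold Rdiv.
destruct (Rle_dec 0 (fst p)).
- now rewrite Rabs_pos_eq.
- rewrite Rabs_left by lra; ring.
Qed.

(** The square u^2 = 1 - 2m/r of the static potential. *)
Definition lapse_sq (x : R) : R := x ^ 2 / r x.

Definition tau_profile (w : R) : R := -1 - 3 * w + w ^ 2 - w ^ 3 / 5.

Definition tau_limit (alpha : R) (p : RV3) : R :=
  alpha / (64 * m ^ 4) * tau_profile (lapse_sq (fst p)).

Lemma stereo_fst c q : fst (stereo c q) = coord I0 q.
Proof. now destruct q as [[x a] b]. Qed.

Lemma elementary_tau_profile : elementary (fun q => tau_profile (lapse_sq (coord I0 q))).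
Proof.
set (w := fun q => (coord I0 q * coord I0 q) * / r (coord I0 q)).
assert (Hw : elementary w).
{ repeat constructor; intros p; apply Rgt_not_eq, area_radius_pos, hm. }
replace (fun q => _) with
  (fun q => -1 + (-3 * w q + (w q * w q + (-1/5) * (w q * (w q * w q))))).
- repeat (assumption || constructor).
- apply functional_extensionality; intros q; unfold tau_profile, lapse_sq, w, Rdiv; ring.
Qed.

Lemma smooth_tau_limit alpha : smooth_fun (tau_limit alpha).
Proof.
intros c; apply elementary_smooth; unfold in_chart, tau_limit.
replace (fun q => _)
  with (fun q => alpha / (64 * m ^ 4) * tau_profile (lapse_sq (coord I0 q)))
  by (apply functional_extensionality; intros q; now rewrite stereo_fst).
repeat (apply elementary_tau_profile || constructor).
Qed.

(** The general potential as a function of x, with its first two derivatives.  With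
    w = [lapse_sq x], the derivative of w is 4 m x / r^2. *)
Definition pot (k c x : R) : R := k * tau_profile (lapse_sq x) + c * (x * / sqrt (r x)).
Definition pot' (k c x : R) : R := let w := lapse_sq x in
  k * ((-3 + 2 * w - 3 / 5 * w ^ 2) * (4 * m * x / r x ^ 2))
  + c * (2 * m / r x * / sqrt (r x)).
Definition pot'' (k c x : R) : R := let w := lapse_sq x in
  k * ((2 - 6 / 5 * w) * (4 * m * x / r x ^ 2) ^ 2
       + (-3 + 2 * w - 3 / 5 * w ^ 2) * (4 * m * (2 * m - 3 * x ^ 2) / r x ^ 3))
  + c * (- (6 * m * x) / r x ^ 2 * / sqrt (r x)).

Lemma in_chart_potential alpha c ch :
  in_chart ch (potential m c (tau_limit alpha))
  = fun q => pot (alpha / (16 * m ^ 2)) c (coord I0 q).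
Proof.
apply functional_extensionality; intros q.
unfold in_chart, potential, pot; rewrite u_pot_eq; unfold tau_limit; rewrite stereo_fst.
field; repeat split; try lra.
apply Rgt_not_eq, sqrt_lt_R0, area_radius_pos, hm.
Qed.

Lemma smooth_potential alpha c : smooth_fun (potential m c (tau_limit alpha)).
Proof.
intros ch; apply elementary_smooth; rewrite in_chart_potential; unfold pot.
repeat (apply elementary_tau_profile || constructor).
- intros p; apply area_radius_pos, hm.
- intros p; apply Rgt_not_eq, sqrt_lt_R0, area_radius_pos, hm.
Qed.

(** With k = sqrt r and m = (k^2 - x^2)/2 an identity becomes rational in k and x. *)
Ltac sqrt_field x :=
  let Hs := fresh in let Hp := fresh in let k := fresh "k" in
  pose proof (sqrt_sqrt (r x) (Rlt_le _ _ (area_radius_pos m x hm))) as Hs;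
  pose proof (sqrt_lt_R0 _ (area_radius_pos m x hm)) as Hp;
  unfold area_radius in *; simpl; simpl in Hs, Hp;
  change (x * (x * 1)) with (x ^ 2) in *;
  set (k := sqrt (2 * m + x ^ 2)) in *; clearbody k;
  replace m with ((k * k - x ^ 2) / 2) by lra;
  field; repeat split; nra.

Ltac radial_derive :=
  evar_last;
  [ auto_derive; [|reflexivity]; repeat split; try exact I;
    repeat (apply Rmult_integral_contrapositive_currified || apply pow_nonzero);
    try apply Rgt_not_eq; try apply sqrt_lt_R0; (lra || apply area_radius_pos, hm)
  | ].

Lemma is_derive_pot k c (x : R) : is_derive (pot k c) x (pot' k c x).
Proof.
unfold pot, pot', tau_profile, lapse_sq, area_radius.
radial_derive.
sqrt_field x.
Qed.

Lemma is_derive_pot' k c (x : R) : is_derive (pot' k c) x (pot'' k c x).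
Proof.
unfold pot', pot'', tau_profile, lapse_sq, area_radius.
radial_derive.
sqrt_field x.
Qed.

(** The u-part drops out, u being harmonic; the value -24 k m^4 / r^6 is
    -(alpha/4) |Ric|^2 when k = alpha / (16 m^2). *)
Lemma laplacian_potential k c p :
  laplacian (double_chart m) (fun q => pot k c (coord I0 q)) p
  = - (24 * k * m ^ 4 / r (coord I0 p) ^ 6).
Proof.
destruct p as [[x a] b].
unfold laplacian; rewrite trace2_double by exact hm.
rewrite !(hess_radial_double m hm (pot k c) (pot' k c) (pot'' k c))
  by (apply is_derive_pot || apply is_derive_pot').
unfold radial_hess, double_chart_inv, spherical, pot', pot'', lapse_sq; cbn [coord].
set (h := / sqrt _); unfold area_radius, stereo_den; field; nonzero.
Qed.

(** Both the hessian of u and u Ric are rational multiples of / sqrt r, so treating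
    / sqrt r as an independent variable h suffices. *)
Lemma Rs2_tensor_equation alpha c i j p :
  alpha * grad_R2 (double_chart m) i j p
  + Lstar (double_chart m) (fun q => pot (alpha / (16 * m ^ 2)) c (coord I0 q)) i j p = 0.
Proof.
destruct p as [[x a] b].
unfold Lstar; rewrite laplacian_potential, grad_R2_double, ric_double by exact hm.
rewrite !(hess_radial_double m hm (pot _ c) (pot' _ c) (pot'' _ c))
  by (apply is_derive_pot || apply is_derive_pot').
destruct i, j;
unfold radial_hess, double_chart, double_ric, spherical, pot, pot', pot'', tau_profile,
  lapse_sq; cbn [coord];
set (h := / sqrt _); unfold area_radius, stereo_den; field; nonzero.
Qed.

Lemma potential_satisfies_Rs2 alpha c :
  satisfies_Rs2 (double_schwarzschild m) alpha (potential m c (tau_limit alpha)).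
Proof.
split; [|split].
- apply smooth_potential.
- intros; rewrite metric_in_chart_double, in_chart_potential by exact hm.
  apply Rs2_tensor_equation.
- intros ch [[x a] b]; rewrite metric_in_chart_double, in_chart_potential by exact hm.
  rewrite normsq2_ric_double by exact hm; etransitivity; [apply laplacian_potential|].
  cbn [coord]; unfold area_radius; field; nonzero.
Qed.
End Potential.

(** * The explicit formula for the potential *)

Lemma Rpower_three_halves v : 0 < v -> Rpower v (3 / 2) = sqrt v ^ 3.
Proof.
intros Hv; replace (3 / 2) with (1 + / 2) by field.
rewrite Rpower_plus, Rpower_1, Rpower_sqrt by exact Hv.
rewrite <- (sqrt_sqrt v) at 1 by lra; ring.
Qed.

Lemma is_lim_even (f : R -> R) l : (forall x, f (- x) = f x) ->
  is_lim f p_infty l -> is_lim f m_infty l.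
Proof.
intros He Hl.
apply (is_lim_ext (fun x => f (- x))); [exact He|].
apply (is_lim_comp f Ropp m_infty l p_infty).
- exact Hl.
- apply (is_lim_opp (fun x => x) m_infty m_infty), is_lim_id.
- now exists 0.
Qed.

Section Limit.
Variables m alpha : R.
Hypothesis hm : 0 < m.

(** The primitive of (1 - v^2)^3 / (8 m^4 v^2). *)
Definition integrand_primitive (v : R) : R :=
  (- / v - 3 * v + v ^ 3 - v ^ 5 / 5) / (8 * m ^ 4).

Lemma lapse_pos s : 2 * m < s -> 0 < 1 - 2 * m / s.
Proof.
intros Hs; apply Rlt_0_minus, (Rmult_lt_reg_r s); [lra|].
unfold Rdiv; rewrite Rmult_assoc, Rinv_l; lra.
Qed.

Lemma is_derive_integrand_primitive s : 2 * m < s ->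
  is_derive (fun s => integrand_primitive (sqrt (1 - 2 * m / s))) s
    (/ (s ^ 5 * Rpower (1 - 2 * m / s) (3 / 2))).
Proof.
intros Hs; pose proof (lapse_pos s Hs) as Hv.
pose proof (sqrt_lt_R0 _ Hv) as Hu.
pose proof (sqrt_sqrt _ (Rlt_le _ _ Hv)) as Huu.
rewrite Rpower_three_halves by exact Hv.
unfold integrand_primitive.
evar_last.
- auto_derive; [|reflexivity].
  repeat split; try exact Hv; try (apply Rgt_not_eq; exact Hu); lra.
- replace (1 + - (2 * m / s)) with (1 - 2 * m / s) by ring.
  set (u := sqrt _) in *; clearbody u.
  assert (E : m = s * (1 - u * u) / 2) by (rewrite Huu; field; lra).
  assert (E' : 1 - u * u <> 0).
  { rewrite Huu; apply Rgt_not_eq; ring_simplify.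
    apply Rdiv_lt_0_compat; lra. }
  rewrite E; field. repeat split; try exact E'; lra.
Qed.

(** The -1/v poles of the primitive at v = u(a) and of the boundary term cancel,
    leaving an odd polynomial in u(a), which vanishes at u(a) = 0. *)
Lemma tau_a_closed a s : 2 * m < a -> a <= s ->
  let v := sqrt (1 - 2 * m / a) in
  tau_a m alpha a s =
    alpha / (64 * m ^ 4) * tau_profile (1 - 2 * m / s)
    + alpha / (64 * m ^ 4) * sqrt (1 - 2 * m / s) * (6 * v - 4 * v ^ 3 + 6 / 5 * v ^ 5).
Proof.
intros Ha Has v; unfold tau_a.
assert (HI : is_RInt (fun s => / (s ^ 5 * Rpower (1 - 2 * m / s) (3 / 2))) a s
   (minus (integrand_primitive (sqrt (1 - 2 * m / s)))
     (integrand_primitive (sqrt (1 - 2 * m / a))))).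
{ apply (is_RInt_derive (fun s => integrand_primitive (sqrt (1 - 2 * m / s)))).
  - rewrite Rmin_left, Rmax_right by exact Has.
    intros t Ht; apply is_derive_integrand_primitive; lra.
  - rewrite Rmin_left, Rmax_right by exact Has.
    intros t Ht; assert (Ht' : 2 * m < t) by lra.
    pose proof (lapse_pos t Ht') as Hv.
    pose proof (sqrt_lt_R0 _ Hv) as Hu.
    apply (continuous_ext_loc _ (fun t => / (t ^ 5 * sqrt (1 - 2 * m / t) ^ 3))).
    + apply (filter_imp (fun t => 2 * m < t)).
      * intros y Hy; now rewrite Rpower_three_halves by now apply lapse_pos.
      * now apply open_gt.
    + apply (ex_derive_continuous (V := R_NormedModule)); auto_derive.
      repeat split; try exact Hv; try lra.
      repeat apply Rmult_integral_contrapositive_currified;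
        (lra || (apply Rgt_not_eq, sqrt_lt_R0, Hv)). }
rewrite (is_RInt_unique _ _ _ _ HI).
pose proof (lapse_pos a Ha) as Hv; pose proof (sqrt_lt_R0 _ Hv) as Hu.
pose proof (sqrt_sqrt _ (Rlt_le _ _ Hv)) as Huu.
assert (Hs : 2 * m < s) by lra.
pose proof (lapse_pos s Hs) as Hv'; pose proof (sqrt_lt_R0 _ Hv') as Hu'.
pose proof (sqrt_sqrt _ (Rlt_le _ _ Hv')) as Huu'.
(* the third occurrence is the argument of tau_profile *)
rewrite <- Huu' at 3.
fold v in Hu, Huu |- *; set (u := sqrt (1 - 2 * m / s)) in *.
(* since 1 - v^2 = 2m/a *)
replace (/ (m * a ^ 3)) with ((1 - v * v) ^ 3 / (8 * m ^ 4))
  by (rewrite Huu; field; lra).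
unfold minus, plus, opp; cbn -[pow].
unfold integrand_primitive, tau_profile; field; lra.
Qed.

Lemma tau_a_limit s : 2 * m < s ->
  filterlim (fun a => tau_a m alpha a s) (at_right (2 * m))
    (locally (alpha / (64 * m ^ 4) * tau_profile (1 - 2 * m / s))).
Proof.
intros Hs.
set (K := alpha / (64 * m ^ 4)).
set (u := sqrt (1 - 2 * m / s)).
set (P := fun v => K * tau_profile (1 - 2 * m / s)
    + K * u * (6 * v - 4 * v ^ 3 + 6 / 5 * v ^ 5)).
apply (filterlim_ext_loc (fun a => P (sqrt (1 - 2 * m / a)))).
- exists (mkposreal (s - 2 * m) (proj2 (Rlt_0_minus _ _) Hs)); intros a Ba Ha.
  symmetry; apply tau_a_closed; [exact Ha|].
  apply Rabs_lt_between' in Ba; cbn in Ba; lra.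
- replace (K * tau_profile (1 - 2 * m / s)) with (P (sqrt (1 - 2 * m / (2 * m)))).
  + eapply filterlim_filter_le_1; [apply filter_le_within|].
    apply (continuous_comp (fun a => sqrt (1 - 2 * m / a)) P).
    * apply (continuous_comp (fun a => 1 - 2 * m / a) sqrt).
      -- apply (ex_derive_continuous (V := R_NormedModule)); auto_derive; lra.
      -- apply continuous_sqrt.
    * apply (ex_derive_continuous (V := R_NormedModule)); unfold P; auto_derive; exact I.
  + replace (1 - 2 * m / (2 * m)) with 0 by (field; lra).
    rewrite sqrt_0; unfold P; ring.
Qed.

Lemma lapse_sq_area x : lapse_sq m x = 1 - 2 * m / area_radius m x.
Proof. unfold lapse_sq, area_radius; field; nra. Qed.

Lemma lapse_sq_bounds x : 0 <= lapse_sq m x < 1.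
Proof.
rewrite lapse_sq_area; pose proof (area_radius_pos m x hm).
assert (2 * m / area_radius m x > 0) by (apply Rdiv_lt_0_compat; lra).
split; [|lra].
rewrite <- lapse_sq_area; unfold lapse_sq; apply Rdiv_le_0_compat; nra.
Qed.

Lemma tau_profile_neg w : 0 <= w < 1 -> tau_profile w < 0.
Proof. unfold tau_profile; intros; nra. Qed.

Lemma lapse_sq_even x : lapse_sq m (- x) = lapse_sq m x.
Proof. unfold lapse_sq, area_radius; now replace ((- x) ^ 2) with (x ^ 2) by ring. Qed.

Lemma is_lim_lapse_sq : is_lim (lapse_sq m) p_infty 1.
Proof.
apply (is_lim_le_le_loc (fun x => 1 - 2 * m / x) (fun _ => 1)).
- exists 1; intros x Hx; rewrite lapse_sq_area.
  assert (2 * m / area_radius m x <= 2 * m / x).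
  { apply Rmult_le_compat_l; [lra|]; apply Rinv_le_contravar; unfold area_radius; nra. }
  pose proof (lapse_sq_bounds x) as B; rewrite lapse_sq_area in B; lra.
- apply (is_lim_ext (fun x => 1 - 2 * m * / x)); [reflexivity|].
  replace (Finite 1) with (Finite (1 - 2 * m * 0)) by (f_equal; ring).
  apply is_lim_minus'; [apply is_lim_const|].
  apply (is_lim_scal_l (fun x => / x) (2 * m) p_infty 0).
  apply (is_lim_inv (fun x => x) p_infty p_infty); [apply is_lim_id | discriminate].
- apply is_lim_const.
Qed.

Lemma is_lim_tau_limit : is_lim (fun x => alpha / (64 * m ^ 4) * tau_profile (lapse_sq m x))
  p_infty (alpha / (64 * m ^ 4) * tau_profile 1).
Proof.
apply (is_lim_comp_continuous (lapse_sq m)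
  (fun w => alpha / (64 * m ^ 4) * tau_profile w) _ _).
- apply is_lim_lapse_sq.
- apply (ex_derive_continuous (V := R_NormedModule)); unfold tau_profile; auto_derive; exact I.
Qed.

Lemma Derive_tau_0 :
  Derive (fun x => alpha / (64 * m ^ 4) * tau_profile (lapse_sq m x)) 0 = 0.
Proof.
rewrite (Derive_ext _ (pot m (alpha / (64 * m ^ 4)) 0)) by (intros x; unfold pot; ring).
rewrite (is_derive_unique _ _ _ (is_derive_pot m hm _ 0 0)).
unfold pot', lapse_sq; unfold Rdiv; ring.
Qed.
End Limit.

(** * The theorem *)

Theorem proposition5p1 (m alpha : R) (hm : 0 < m) (halpha : 0 < alpha) :
  riemannian (double_schwarzschild m) /\
  complete_metric (double_schwarzschild m) /\
  doubles_schwarzschild m (area_radius m) (double_schwarzschild m) /\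
  scalar_flat (double_schwarzschild m) /\
  exists tau : RV3 -> R,
    smooth_fun tau /\
    (forall x y y', on_S2 y -> on_S2 y' -> tau (x, y) = tau (x, y')) /\
    (forall p, on_N p -> tau (reflect p) = tau p) /\
    (forall p, on_N p -> 2 * m < area_radius m (fst p) ->
       filterlim (fun a => tau_a m alpha a (area_radius m (fst p)))
                 (at_right (2 * m)) (locally (tau p))) /\
    (forall c : R,
       satisfies_Rs2 (double_schwarzschild m) alpha (potential m c tau)) /\
    (forall y, on_S2 y -> tau (0, y) = - (alpha / (8 * m)) * / (2 * m) ^ 3) /\
    (forall y, on_S2 y ->
       radial_derive (double_schwarzschild m) tau (0, y) = 0) /\
    (forall p, on_N p -> tau p < 0) /\
    (exists tau_o : R, tau_o < 0 /\
       forall y, on_S2 y ->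
         is_lim (fun x => tau (x, y)) p_infty tau_o /\
         is_lim (fun x => tau (x, y)) m_infty tau_o).
Proof.
split; [now apply double_riemannian|].
split; [now apply double_complete|].
split; [now apply double_doubles_schwarzschild|].
split.
{ intros c q; rewrite metric_in_chart_double by exact hm.
  now apply scalar_curv_double. }
assert (Hk : 0 < alpha / (64 * m ^ 4)).
{ apply Rdiv_lt_0_compat; [exact halpha|].
  apply Rmult_lt_0_compat; [lra | now apply pow_lt]. }
exists (tau_limit m alpha).
split; [now apply smooth_tau_limit|].
split; [reflexivity|].
split.
{ intros p _; unfold tau_limit, reflect; cbn [fst]; now rewrite lapse_sq_even. }
split.
{ intros p _ Hp; unfold tau_limit; rewrite lapse_sq_area by exact hm.
  now apply tau_a_limit. }
split; [intros c; now apply potential_satisfies_Rs2|].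
split.
{ intros y _; unfold tau_limit, tau_profile, lapse_sq, area_radius; cbn [fst].
  field; lra. }
split.
{ intros y _; unfold radial_derive, tau_limit; cbn [fst snd].
  rewrite Derive_tau_0 by exact hm; unfold Rdiv; ring. }
split.
{ intros p _; unfold tau_limit.
  pose proof (tau_profile_neg _ (lapse_sq_bounds m hm (fst p))); nra. }
exists (alpha / (64 * m ^ 4) * tau_profile 1); split.
{ unfold tau_profile; nra. }
intros y _; unfold tau_limit; cbn [fst].
assert (Hlim := is_lim_tau_limit m alpha hm); split; [exact Hlim|].
apply (is_lim_even (fun x => alpha / (64 * m ^ 4) * tau_profile (lapse_sq m x)));
  [|exact Hlim].
intros x; now rewrite lapse_sq_even.
Qed.
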